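(* Assume $k$ has characteristic $0$. Let $I$ be an $\mathfrak m$-primary monomial ideal of $S = k[x_1,\ldots,x_n]$ with asymptotic generating degree $d$, let $l$ be the number of variables $x_i$ such that $x_i^d$ is a minimal generator of $I$, and write $\operatorname{reg} I^m = dm + e_m$ for all $m$. Then $e_{m+1} = e_m$ for all $$m > \max\{n-1,\ (n-1)[l(d-1) - 1]\}.$$
   Context: $S = k[x_1,\ldots,x_n]$ is a polynomial ring over a field $k$ in $n$ variables with its standard grading, $\mathfrak m = (x_1,\ldots,x_n)$, and $\operatorname{reg}$ denotes Castelnuovo-Mumford regularity. $m$ ranges over positive integers. $I_{\leq t}$ denotes the ideal generated by the forms in $I$ of degree at most $t$; the asymptotic generating degree of $I$ is the minimal number $d$ such that $I$ is integral over $I_{\leq d}$. An $\mathfrak m$-primary monomial ideal has a pure power of each variable among its minimal generators, and $d$ is the largest exponent of these pure powers. *)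

(* Defs.v *)
From HB Require Import structures.
From mathcomp Require Import all_boot all_order all_algebra.
From mathcomp Require Import boolp.
From mathcomp Require Import mpoly.
Set Implicit Arguments.
Unset Strict Implicit.
Unset Printing Implicit Defensive.
Import Order.TTheory GRing.Theory Num.Theory.
Local Open Scope ring_scope.

(* Ideals are Prop-valued predicates on the ring. *)
Section Ideals.
Variable R : comNzRingType.
Implicit Types I J M A : R -> Prop.

Definition ideal_span A (f : R) : Prop :=
  exists (r : nat) (c g : 'I_r -> R),
    (forall i, A (g i)) /\ f = \sum_(i < r) c i * g i.

Definition ideal_mul I J : R -> Prop :=
  ideal_span (fun p => exists f g, [/\ I f, J g & p = f * g]).

Fixpoint ideal_pow I (m : nat) : R -> Prop :=
  if m is m'.+1 then ideal_mul I (ideal_pow I m') else fun _ => True.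

Definition primary_ideal I : Prop :=
  ~ I 1 /\ forall f g, I (f * g) -> I f \/ exists r : nat, I (g ^+ r).

Definition primary_to M I : Prop :=
  primary_ideal I /\ forall f, (exists r : nat, I (f ^+ r)) <-> M f.

Definition integral_over_ideal J (f : R) : Prop :=
  exists (r : nat) (a : nat -> R),
    [/\ (0 < r)%N,
        forall j, (1 <= j <= r)%N -> ideal_pow J j (a j) &
        f ^+ r + \sum_(1 <= j < r.+1) a j * f ^+ (r - j) = 0].

End Ideals.

Section PolynomialIdeals.
Variables (n : nat) (k : fieldType).
Local Notation S := {mpoly k[n]}.
Implicit Types I : S -> Prop.

Definition irrelevant_ideal : S -> Prop :=
  ideal_span (fun p : S => exists i : 'I_n, p = 'X_i).

Definition monomial_ideal I : Prop :=
  exists A : 'X_{1..n} -> Prop,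
    forall f, I f <-> ideal_span (fun p : S => exists2 a, A a & p = 'X_[a]) f.

(* For a monomial ideal, the minimal monomial generators are the monomials of
   the ideal that are minimal with respect to divisibility. *)
Definition minimal_monomial_generator I (a : 'X_{1..n}) : Prop :=
  I 'X_[a] /\ forall b : 'X_{1..n}, I 'X_[b] -> (b <= a)%MM -> b = a.

Definition num_pure_powers I (d : nat) : nat :=
  #|[set i : 'I_n | `[< minimal_monomial_generator I (U_(i) *+ d)%MM >]]|.

Definition ideal_le_degree I (t : nat) : S -> Prop :=
  ideal_span (fun p : S => I p /\ exists2 s : nat, (s <= t)%N & p \is s.-homog).

Definition integral_over_le_degree I (t : nat) : Prop :=
  forall f, I f -> integral_over_ideal (ideal_le_degree I t) f.

Definition asymptotic_generating_degree I (d : nat) : Prop :=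
  integral_over_le_degree I d /\
  forall t : nat, integral_over_le_degree I t -> (d <= t)%N.

(* A minimal graded free resolution ... -> F_1 -> F_0 -> I -> 0, where F_i is
   the direct sum of the S(- shift i a) for a : 'I_(rank i).  Elements of F_i
   are row vectors and the maps act by right multiplication.  In [diff_homog],
   requiring mdeg u + shift i b = shift i.+1 a on the support also forces the
   entry to vanish when shift i.+1 a < shift i b. *)
Record min_graded_free_resolution I := MinGradedFreeResolution {
  rank : nat -> nat;
  shift : forall i, 'I_(rank i) -> nat;
  aug : 'cV[S]_(rank 0);
  diff : forall i, 'M[S]_(rank i.+1, rank i);
  aug_homog : forall a : 'I_(rank 0), aug a 0 \is (shift a).-homog;
  diff_homog : forall i (a : 'I_(rank i.+1)) (b : 'I_(rank i)) (u : 'X_{1..n}),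
    u \in msupp (diff i a b) -> (mdeg u + shift b)%N = shift a;
  aug_image : forall f : S,
    I f <-> exists v : 'rV[S]_(rank 0), f = (v *m aug) 0 0;
  aug_exact : forall v : 'rV[S]_(rank 0),
    v *m aug = 0 <-> exists w : 'rV[S]_(rank 1), v = w *m diff 0;
  diff_exact : forall i (v : 'rV[S]_(rank i.+1)),
    v *m diff i = 0 <-> exists w : 'rV[S]_(rank i.+2), v = w *m diff i.+1;
  diff_minimal : forall i (a : 'I_(rank i.+1)) (b : 'I_(rank i)),
    irrelevant_ideal (diff i a b)
}.

(* reg I = r, i.e. r is the maximum of (shift - homological degree) over a
   minimal graded free resolution of I, which is unique up to isomorphism. *)
Definition castelnuovo_mumford_regularity I (r : int) : Prop :=
  exists F : min_graded_free_resolution I,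
    (exists i (a : 'I_(rank F i)), r = (shift a)%:Z - i%:Z) /\
    forall i (a : 'I_(rank F i)), (shift a)%:Z - i%:Z <= r.

End PolynomialIdeals.

(* Main.v *)
Require Import Defs.
From HB Require Import structures.
From mathcomp Require Import all_boot all_order all_algebra.
From mathcomp Require Import boolp.
From mathcomp Require Import mpoly.
From mathcomp Require Import zify.
Set Implicit Arguments.
Unset Strict Implicit.
Unset Printing Implicit Defensive.
Import Order.TTheory GRing.Theory Num.Theory.
Local Open Scope ring_scope.

(** For a proper monomial ideal [J] containing a power of every variable,
    the quotient [S/J] has finite length and
    [reg J = 1 + max {deg u : u is a monomial outside J}]
    ([regularity_cofinite_monomial]).  With [t_m] the largest degree of a
    monomial outside [I^m], the theorem becomes [t_(m+1) = t_m + d], a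
    statement about exponent vectors only.

    The regularity formula is read off a minimal resolution
    [... -> F_1 -> F_0 -> S] of [S/J] by killing the variables one at a time.
    The homology of the complex modulo [x_1, ..., x_p] is
    [Tor(S/J, S/(x_1, ..., x_p))], and the long exact sequence of
    multiplication by [x_(p+1)] passes from [p] to [p+1].  It shows that the
    [i]-th homology lives in degrees at most [t + i], where [t] is the top
    degree of [S/J] ([cycle_mod_boundary]), and that a nonzero class of degree
    [t + p] in homological degree [p] yields one of degree [t + p + 1] in
    homological degree [p + 1] ([socle_lift]).  For [p = n] the differentials
    vanish by minimality, so these classes are exactly the shifts.

    Let [c_j] be the least exponent with [x_j^(c_j)] in [I].  The asymptotic
    generating degree is [max_j c_j]: integrality over [I_(<= t)] forces a pure
    power of each variable into [I_(<= t)] ([pure_exponent_le]).  Conversely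
    let [t >= max_j c_j] and split [f] in [I] as [p + q] according to degree
    [<= t] and [> t]; then [p] lies in [I_(<= t)] and a high power
    [q^r = (f - p)^r] lies in [I_(<= t)^r], and expanding it gives the
    integral equation ([integral_over_max_pure_degree]).

    It remains to compare [t_m] and [t_(m+1)].  As soon as [m >= n], a monomial
    of top degree outside [I^(m+1)] is divisible by some [x_j^(c_j)], and
    dividing by it leaves a monomial outside [I^m] ([exp_pow_drop]).
    In the other direction write [a_j = q_j c_j + r_j] with [r_j < c_j] for a
    monomial [x^a] outside [I^m] of top degree, and fix [i] with [c_i = d].
    Trading all the factors [x_j^(c_j)], [j != i], for powers of [x_i^d] gives
    a monomial outside [I^(m+1)] of degree at least [deg x^a + d], provided
    [a_i >= (m - sum_(j != i) q_j) (d - 1)]: a product with so many factors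
    that [x_i^d] cannot be cancelled from it often enough has many factors of
    [x_i]-degree below [d] ([exp_pow_cancel_pure]).  If the inequality fails
    for every such [i], then summing over [i] bounds [deg x^a], hence [m], and
    the bound is exceeded by assumption ([exp_pow_rise]). *)

(** * Exponent vectors of powers of a monomial ideal *)

Definition up_closed n (E : 'X_{1..n} -> Prop) : Prop :=
  forall a b : 'X_{1..n}, (a <= b)%MM -> E a -> E b.

(** The exponents of the monomials in [I^m], when [E] is the up-closed set of
    exponents of a monomial ideal [I]. The sum is only required to lie below
    [u], so that [exp_pow E 0] is everything, matching [I^0 = S]. *)
Definition exp_pow n (E : 'X_{1..n} -> Prop) (m : nat) (u : 'X_{1..n}) : Prop :=
  exists s : seq 'X_{1..n},
    [/\ size s = m, forall g, g \in s -> E g &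
        forall j, (\sum_(g <- s) g j <= u j)%N].

Lemma exp_pow_le n (E : 'X_{1..n} -> Prop) m u v :
  (u <= v)%MM -> exp_pow E m u -> exp_pow E m v.
Proof.
move=> /mnm_lepP le_uv [s [sz sE sle]]; exists s; split=> // j.
exact: leq_trans (sle j) (le_uv j).
Qed.

Lemma exp_pow_up n (E : 'X_{1..n} -> Prop) m : up_closed (exp_pow E m).
Proof. by move=> u v; apply: exp_pow_le. Qed.

Lemma exp_pow_leq n (E : 'X_{1..n} -> Prop) p m u :
  (p <= m)%N -> exp_pow E m u -> exp_pow E p u.
Proof.
move=> le_pm [s [sz sE sle]]; exists (take p s); split.
- by rewrite size_take sz; case: ltngtP le_pm.
- by move=> g /mem_take /sE.
- move=> j; apply: leq_trans (sle j).
  by rewrite -{2}(cat_take_drop p s) big_cat leq_addr.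
Qed.

Lemma exp_powD n (E : 'X_{1..n} -> Prop) p q b c :
  exp_pow E p b -> exp_pow E q c -> exp_pow E (p + q) (b + c)%MM.
Proof.
move=> [s [sz sE sle]] [t [tz tE tle]]; exists (s ++ t); split.
- by rewrite size_cat sz tz.
- by move=> g; rewrite mem_cat => /orP[/sE|/tE].
- by move=> j; rewrite big_cat mnmDE leq_add.
Qed.

Lemma exp_powMn n (E : 'X_{1..n} -> Prop) m g :
  E g -> exp_pow E m (g *+ m)%MM.
Proof.
move=> Eg; exists (nseq m g); split.
- by rewrite size_nseq.
- by move=> h /nseqP[->].
- by move=> j; rewrite mulmnE big_nseq iter_addn_0.
Qed.

Lemma exp_powS_add n (E : 'X_{1..n} -> Prop) m u v :
  E u -> exp_pow E m v -> exp_pow E m.+1 (u + v)%MM.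
Proof.
move=> Eu; apply: (@exp_powD _ _ 1); rewrite -[u]mulm1n.
exact: exp_powMn.
Qed.

Lemma exp_powS n (E : 'X_{1..n} -> Prop) m u :
  exp_pow E m.+1 u ->
  exists g, [/\ E g, (g <= u)%MM & exp_pow E m (u - g)%MM].
Proof.
move=> [[|g s] [//= [sz] sE sle]]; exists g; split.
- by apply: sE; rewrite mem_head.
- apply/mnm_lepP => j; apply: leq_trans (sle j).
  by rewrite big_cons leq_addr.
- exists s; split=> // [h hs|j]; first by apply: sE; rewrite inE hs orbT.
  by rewrite mnmBE; have := sle j; rewrite big_cons; lia.
Qed.

Lemma exp_pow0 n (E : 'X_{1..n} -> Prop) u : exp_pow E 0 u.
Proof. by exists [::]; split=> // j; rewrite big_nil. Qed.

Lemma exp_pow_pure n (E : 'X_{1..n} -> Prop) (P : pred 'I_n)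
    (c s : 'I_n -> nat) (u : 'X_{1..n}) :
  (forall j, E (U_(j) *+ c j)%MM) ->
  (forall j, P j -> s j * c j <= u j)%N ->
  exp_pow E (\sum_(j | P j) s j) u.
Proof.
move=> cE cle.
apply: (@exp_pow_le _ _ _ (\sum_(j | P j) U_(j) *+ c j *+ s j)%MM).
  apply/mnm_lepP => i; rewrite mnm_sumE.
  have sum0 (Q : pred 'I_n) : ~~ Q i ->
      (\sum_(j | Q j) ((U_(j) *+ c j) *+ s j)%MM i = 0)%N.
    move=> Qi; rewrite big1 // => j Qj; rewrite !mulmnE mnm1E.
    by case: eqP Qj Qi => [->->|].
  case Pi: (P i); last by rewrite sum0 ?Pi.
  rewrite (bigD1 i) //= sum0 ?eqxx ?andbF // !mulmnE mnm1E eqxx mul1n addn0.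
  by rewrite mulnC cle.
elim/big_ind2: _ => [|p b q e|j _]; first exact: exp_pow0.
- by move=> *; apply: exp_powD.
- exact: exp_powMn.
Qed.

Lemma sum_coord_le n (s : seq 'X_{1..n}) (i : 'I_n) (c : nat) :
  (forall g, g \in s -> g i <= c)%N -> (\sum_(g <- s) g i <= size s * c)%N.
Proof.
move=> sle; rewrite -sum1_size big_distrl /= big_seq [leqRHS]big_seq.
by apply: leq_sum => g /sle; rewrite mul1n.
Qed.

Lemma sum_coord_ge n (s : seq 'X_{1..n}) (i : 'I_n) (c : nat) :
  (forall g, g \in s -> c <= g i)%N -> (size s * c <= \sum_(g <- s) g i)%N.
Proof.
move=> sle; rewrite -sum1_size big_distrl /= big_seq [leqRHS]big_seq.
by apply: leq_sum => g /sle; rewrite mul1n.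
Qed.

(** Among [p + N] monomials of [I] whose product divides [x^a x_i^(N d)],
    either at least [N] are divisible by [x_i^d], and
    one [x_i^d] is removed with each of [N] of them; or at least [p] factors
    have [x_i]-degree at most [d - 1], and the product of [p] of those divides
    [x^a] because [a_i >= p (d - 1)]. *)
Lemma exp_pow_cancel_pure n (E : 'X_{1..n} -> Prop) p N d (i : 'I_n)
    (a : 'X_{1..n}) :
  (p * d.-1 <= a i)%N -> exp_pow E (p + N) (a + U_(i) *+ (N * d))%MM ->
  exp_pow E p a.
Proof.
move=> le_ai [s [sz sE sle]].
pose big (g : 'X_{1..n}) := (d <= g i)%N.
pose s1 := filter big s; pose s2 := filter (predC big) s.
have s12 j : (\sum_(g <- s) g j = \sum_(g <- s1) g j + \sum_(g <- s2) g j)%N.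
  by rewrite !big_filter (bigID big).
have sz12 : (size s1 + size s2 = p + N)%N.
  by rewrite !size_filter count_predC sz.
have slej j : j != i -> (\sum_(g <- s1) g j + \sum_(g <- s2) g j <= a j)%N.
  move=> ji; rewrite -s12 (leq_trans (sle j)) // mnmDE mulmnE mnm1E.
  by rewrite eq_sym (negPf ji) addn0.
have slei : (\sum_(g <- s1) g i + \sum_(g <- s2) g i <= a i + N * d)%N.
  by rewrite -s12 (leq_trans (sle i)) // mnmDE mulmnE mnm1E eqxx mul1n.
have [le_p|lt_p] := leqP p (size s2).
  (* Enough factors of small degree in the i-th variable: p of them fit in a. *)
  exists (take p s2); split.
  - by rewrite size_takel.
  - by move=> g /mem_take; rewrite mem_filter => /andP[_ /sE].
  move=> j; have [->|ji] := eqVneq j i.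
    apply: leq_trans le_ai; rewrite -{2}(size_takel le_p).
    apply: sum_coord_le => g /mem_take; rewrite mem_filter /big /= -ltnNge.
    by case/andP; lia.
  apply: leq_trans (slej j ji).
  by rewrite -[in leqRHS](cat_take_drop p s2) big_cat /=; lia.
(* Otherwise N factors of degree at least d in the i-th variable are dropped. *)
have le_N : (N <= size s1)%N by lia.
have take_ge : (N * d <= \sum_(g <- take N s1) g i)%N.
  rewrite -{1}(size_takel le_N); apply: sum_coord_ge => g /mem_take.
  by rewrite mem_filter => /andP[].
have s1E j : (\sum_(g <- s1) g j =
    \sum_(g <- take N s1) g j + \sum_(g <- drop N s1) g j)%N.
  by rewrite -{1}(cat_take_drop N s1) big_cat.
exists (drop N s1 ++ s2); split.
- by rewrite size_cat size_drop; lia.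
- move=> g; rewrite mem_cat => /orP[/mem_drop|];
  by rewrite mem_filter => /andP[_ /sE].
- move=> j; rewrite big_cat /=; have [->|ji] := eqVneq j i.
    by move: slei; rewrite s1E; lia.
  by move: (slej j ji); rewrite s1E; lia.
Qed.

(** [c j] is the exponent of the pure power of [x_j] among the minimal
    generators; positivity says that the ideal is proper. *)
Definition pure_exponents n (E : 'X_{1..n} -> Prop) (c : 'I_n -> nat) : Prop :=
  forall j, (0 < c j)%N /\ forall r, E (U_(j) *+ r)%MM <-> (c j <= r)%N.

Lemma sum_count_le (I : finType) (P : pred I) (f g : I -> nat) (D : nat) :
  (forall j, P j -> f j < g j * D)%N ->
  (\sum_(j | P j) f j + #|P| <= (\sum_(j | P j) g j) * D)%N.
Proof.
move=> fg; rewrite -sum1_card -big_split big_distrl /=.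
by apply: leq_sum => j Pj; rewrite addn1 fg.
Qed.

Lemma sum_count_ord_le n (f g : 'I_n -> nat) (D : nat) :
  (forall j, f j < g j * D)%N -> (\sum_j f j + n <= (\sum_j g j) * D)%N.
Proof.
move=> fg; have := @sum_count_le _ predT f g D (fun j _ => fg j).
by rewrite (@eq_card _ _ 'I_n) ?card_ord.
Qed.

(** Dividing with remainder by the [c j], a monomial contains at least as many
    pure powers [x_j^(c j)] as its degree allows; the remainders cost at most
    [t] per variable. *)
Lemma exp_pow_high_degree n (E : 'X_{1..n} -> Prop) c t m u :
  (forall j, 0 < c j <= t)%N -> (forall j, E (U_(j) *+ c j)%MM) ->
  ((m.-1 + n) * t < mdeg u + n)%N -> exp_pow E m u.
Proof.
move=> ct cE lt_m; have [->|m0] := posnP m; first exact: exp_pow0.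
apply: (@exp_pow_leq _ _ _ (\sum_j u j %/ c j)); last first.
  by apply: exp_pow_pure => // j _; apply: leq_trunc_div.
rewrite leqNgt; apply/negP => lt_q.
have : (mdeg u + n <= (\sum_j u j %/ c j + n) * t)%N.
  rewrite mdegE -[X in (_ <= (_ + X) * _)%N]card_ord -sum1_card -big_split.
  apply: sum_count_ord_le => j /=; rewrite addn1.
  have /andP[c0 cjt] := ct j; apply: leq_trans (ltn_ceil _ c0) _.
  by rewrite leq_mul2l cjt orbT.
apply/negP; rewrite -ltnNge; apply: leq_trans lt_m; rewrite ltnS.
by rewrite leq_mul2r leq_add2r; apply/orP; right; lia.
Qed.

(** If every [a_j] were below [c_j], the degree of [a] would be at most
    [n (d - 1)], too small once [n <= m]. So some [x_j^(c_j)] divides [x^a],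
    and the quotient cannot lie in [I^m]. *)
Lemma exp_pow_drop n (E : 'X_{1..n} -> Prop) c d m (a : 'X_{1..n}) :
  pure_exponents E c -> (forall j, c j <= d)%N ->
  (0 < n <= m)%N -> (d * m.+1 <= (mdeg a).+1)%N -> ~ exp_pow E m.+1 a ->
  exists2 b : 'X_{1..n}, ~ exp_pow E m b & (mdeg a <= mdeg b + d)%N.
Proof.
move=> cE cd /andP[n0 nm] le_a aE.
have [j le_ca] : exists j, (c j <= a j)%N.
  apply: contrapT => /forallNP lt_ac.
  have : (mdeg a + n <= n * d)%N.
    rewrite mdegE -[X in (_ <= X * _)%N]card_ord -sum1_card.
    apply: sum_count_ord_le => j; rewrite mul1n.
    by move: (lt_ac j) (cd j) => /negP; rewrite -ltnNge; apply: leq_trans.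
  have [c0 _] := cE (Ordinal n0); have := cd (Ordinal n0).
  nia.
have le_U : (U_(j) *+ c j <= a)%MM.
  apply/mnm_lepP => i; rewrite mulmnE mnm1E; case: eqP => [<-|]; lia.
exists (a - U_(j) *+ c j)%MM.
  move=> bE; apply: aE; rewrite -(submK le_U) -addn1; apply: exp_powD => //.
  by rewrite -[X in exp_pow _ _ X]mulm1n; apply/exp_powMn/(cE j).2.
have := mdegD (a - U_(j) *+ c j) (U_(j) *+ c j).
by rewrite submK // mdegMn mdeg1; have := cd j; lia.
Qed.

(** Pure powers leave only finitely many monomials outside [I^m], so the top
    degree of [S/I^m] exists. *)
Lemma exp_pow_top n (E : 'X_{1..n} -> Prop) c m :
  pure_exponents E c -> ~ E 0%MM -> (0 < m)%N ->
  exists top, (forall u, (top < mdeg u)%N -> exp_pow E m u) /\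
    exists2 u : 'X_{1..n}, mdeg u = top & ~ exp_pow E m u.
Proof.
move=> cE E0 m0.
pose P j := `[< exists2 u : 'X_{1..n}, mdeg u = j & ~ exp_pow E m u >].
have P0 : exists j, P j.
  exists 0%N; apply/asboolP; exists 0%MM; first exact: mdeg0.
  case: m m0 {P} => // m _ /exp_powS[g [Eg /mnm_lepP g0 _]]; apply: E0.
  suff <- : g = 0%MM by [].
  apply/mnmP => y; apply/eqP; rewrite mnm0E -leqn0.
  by have := g0 y; rewrite mnm0E.
have Pbound j : P j -> (j <= (m.-1 + n) * \max_i c i)%N.
  move=> /asboolP[u <- uN]; rewrite leqNgt; apply/negP => lt_u; apply: uN.
  apply: (exp_pow_high_degree (c := c)) => [i|i|].
  - by apply/andP; split; [exact: (cE i).1 | exact: leq_bigmax].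
  - exact/(cE i).2.
  - exact: leq_trans lt_u (leq_addr _ _).
have [top /asboolP Ptop topmax] := ex_maxnP P0 Pbound.
exists top; split=> // u lt_u; apply: contrapT => uN.
have : P (mdeg u) by apply/asboolP; exists u.
by move/topmax; rewrite leqNgt lt_u.
Qed.

Lemma exp_pow_pure_below n (E : 'X_{1..n} -> Prop) c m (i : 'I_n) r :
  pure_exponents E c -> (r < m * c i)%N -> ~ exp_pow E m (U_(i) *+ r)%MM.
Proof.
move=> cE lt_r [s [sz sE sle]].
have : (m * c i <= \sum_(g <- s) g i)%N.
  rewrite -sz; apply: sum_coord_ge => g gs; apply/(cE i).2.
  suff -> : (U_(i) *+ g i)%MM = g by exact: sE.
  apply/mnmP => j; rewrite mulmnE mnm1E; case: eqP => [->|/eqP ij].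
    by rewrite mul1n.
  have := sle j; rewrite mulmnE mnm1E (negPf ij) mul0n leqn0.
  by rewrite (big_rem g) //= addn_eq0 => /andP[/eqP->].
by have := sle i; rewrite mulmnE mnm1E eqxx mul1n; lia.
Qed.

(** The counting behind [exp_pow_rise]: there [A] is the degree of [a], [s] is
    the sum of all quotients [q_j], [Q] the part of it coming from the [l]
    indices with [c_j = d], and [t = m - s] the defect.  The bounds
    [d m <= A + 1] and [A + n <= (s + n) d] give [t <= n - 1] when [n >= 2],
    and in the end [t] is only multiplied by [l - 1]. *)
Lemma quotient_count (n d m s t l : nat) (Q A : nat) :
  (0 < d)%N -> (0 < l <= n)%N ->
  (d * m <= A.+1)%N -> (A + n <= (s + n) * d)%N -> (m = s + t)%N ->
  (A + n <= (l * t + Q + (s - Q + (n - l))) * d.-1)%N -> (Q <= s)%N ->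
  (m + n.-1 <= n.-1 * l * d.-1)%N.
Proof.
case: d => // d; case: n => [|n]; first by lia.
case: l => // l _ /andP[_]; rewrite ltnS => ln; rewrite /=.
move=> Hd Hq Em Hp Qs; subst m.
have tn : (l * t <= l * n)%N.
  rewrite leq_mul2l; case: eqP => //= l0.
  rewrite leqNgt; apply/negP => nt.
  have : (d.+1 * n.+1 <= d.+1 * t)%N by rewrite leq_mul2l.
  rewrite mulnDr in Hd.
  rewrite mulnDl [(n.+1 * _)%N]mulnC [(s * _)%N]mulnC in Hq.
  by lia.
have e1 : (l.+1 * t + Q + (s - Q + (n.+1 - l.+1)) =
    s + t + (l * t + (n - l)))%N.
  rewrite subSS mulSn; lia.
rewrite e1 in Hp.
have : (s + t + n <= (l * t + (n - l)) * d)%N by rewrite mulnDl in Hp; nia.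
move=> H; apply: leq_trans H _; rewrite leq_mul2r; apply/orP; right.
by rewrite mulnS [(n * l)%N]mulnC; lia.
Qed.

(** For [i] with [c_i = d], moving every factor [x_j^(c_j)] with [j != i] over
    to the variable [x_i], and adding one more [x_i^d], yields the candidate
    for a monomial outside [I^(m+1)]. It works unless [a_i] is small, by
    [exp_pow_cancel_pure]; all the [a_i] being small is excluded by
    [quotient_count]. *)
Lemma exp_pow_rise n (E : 'X_{1..n} -> Prop) c d m (a : 'X_{1..n}) :
  pure_exponents E c -> (forall j, c j <= d)%N -> (exists i, c i = d) ->
  (n.-1 * #|[pred i | c i == d]| * d.-1 < m + n.-1)%N ->
  (d * m <= (mdeg a).+1)%N -> ~ exp_pow E m a ->
  exists2 b : 'X_{1..n}, ~ exp_pow E m.+1 b & (mdeg a + d <= mdeg b)%N.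
Proof.
move=> cE cd [i0 ci0] bound le_a aE.
pose q j := (a j %/ c j)%N.
pose rest i := (\sum_(j | j != i) q j)%N.
have qE i : (\sum_j q j = q i + rest i)%N by rewrite (bigD1 i).
have q_lt : (\sum_j q j < m)%N.
  rewrite ltnNge; apply/negP => le_m; apply: aE; apply: exp_pow_leq le_m _.
  apply: exp_pow_pure; first by move=> j; apply/(cE j).2.
  by move=> j _; rewrite leq_trunc_div.
pose b i := [multinom (if j == i then a j else a j %% c j)%N | j < n].
(* x^(b i) is x^a with all pure powers of the other variables divided out. *)
have bN i : ~ exp_pow E (m - rest i) (b i).
  move=> bE; apply: aE.
  pose w := [multinom (if j == i then 0 else q j * c j)%N | j < n].
  have wE : exp_pow E (rest i) w.
    apply: exp_pow_pure; first by move=> j; apply/(cE j).2.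
    by move=> j ji; rewrite mnmE (negPf ji).
  have := exp_powD bE wE; rewrite subnK; last by have := qE i; lia.
  apply: exp_pow_le; apply/mnm_lepP => j; rewrite mnmDE !mnmE.
  by case: eqP => _; rewrite ?addn0 // addnC -divn_eq.
have [[i ci le_ai]|noi] :
    (exists2 i, c i = d & (m - rest i) * d.-1 <= a i)%N \/
    (forall i, c i = d -> a i < (m - rest i) * d.-1)%N.
  have [/existsP[i /andP[/eqP ci le_ai]]|/existsPn noi] :=
    boolP [exists i, (c i == d) && ((m - rest i) * d.-1 <= a i)%N].
    by left; exists i.
  by right=> i ci; have := noi i; rewrite ci eqxx /= -ltnNge.
- exists (b i + U_(i) *+ ((rest i).+1 * d))%MM.
    have -> : (m.+1 = (m - rest i) + (rest i).+1)%N by have := qE i; lia.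
    move/exp_pow_cancel_pure => H; apply: (bN i); apply: H.
    by rewrite mnmE eqxx.
  have -> : mdeg a = (a i + \sum_(j | j != i) a j)%N by rewrite mdegE (bigD1 i).
  have bdeg : mdeg (b i) = (a i + \sum_(j | j != i) a j %% c j)%N.
    rewrite mdegE (bigD1 i) //= mnmE eqxx; congr (_ + _)%N.
    by apply: eq_bigr => j ji; rewrite mnmE (negPf ji).
  have : (\sum_(j | j != i) a j <= \sum_(j | j != i) a j %% c j + rest i * d)%N.
    rewrite big_distrl -big_split /=; apply: leq_sum => j _.
    by rewrite {1}(divn_eq (a j) (c j)) addnC leq_add2l leq_mul2l cd orbT.
  by rewrite mdegD mdegMn mdeg1 mul1n mulSn bdeg; lia.
pose L := [pred i | c i == d].
have d0 : (0 < d)%N by rewrite -ci0; case: (cE i0).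
(* On L the entries of a are small because the construction fails there; off L
   they are bounded through c_j <= d - 1, and everywhere through c_j <= d. *)
have Lsum : (\sum_(j | L j) a j + #|L| <=
    (#|L| * (m - \sum_j q j) + \sum_(j | L j) q j) * d.-1)%N.
  have -> : (#|L| * (m - \sum_j q j) + \sum_(j | L j) q j =
      \sum_(j | L j) (m - \sum_j q j + q j))%N.
    by rewrite big_split /= sum_nat_const.
  apply: sum_count_le => j /eqP /noi; congr (_ < _ * _)%N.
  by have := qE j; lia.
have NLsum : (\sum_(j | ~~ L j) a j + (n - #|L|) <=
    (\sum_(j | ~~ L j) q j + (n - #|L|)) * d.-1)%N.
  have -> : (n - #|L| = #|[predC L]|)%N.
    by rewrite -[X in (X - _)%N]card_ord -(cardC L) addKn.
  have -> : (\sum_(j | ~~ L j) q j + #|[predC L]| =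
      \sum_(j | [predC L] j) (q j).+1)%N.
    by rewrite -sum1_card -big_split /=; apply: eq_bigr => j _; rewrite addn1.
  apply: (@sum_count_le _ [predC L]) => j /= Lj.
  apply: leq_trans (_ : (q j).+1 * c j <= _)%N.
    by apply: ltn_ceil; case: (cE j).
  by rewrite leq_mul // -ltnS prednK // ltn_neqAle cd andbT.
have allsum : (\sum_j a j + n <= (\sum_j q j + n) * d)%N.
  rewrite -[X in (_ <= (_ + X) * _)%N]card_ord -sum1_card -big_split.
  apply: sum_count_ord_le => j /=; rewrite addn1.
  apply: leq_trans (_ : (q j).+1 * c j <= _)%N.
    by apply: ltn_ceil; case: (cE j).
  by rewrite leq_mul2l cd orbT.
have aL : (\sum_j a j = \sum_(j | L j) a j + \sum_(j | ~~ L j) a j)%N.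
  by rewrite (bigID L).
have qL : (\sum_j q j = \sum_(j | L j) q j + \sum_(j | ~~ L j) q j)%N.
  by rewrite (bigID L).
have Ln : (0 < #|L| <= n)%N.
  apply/andP; split; last by rewrite -[X in (_ <= X)%N]card_ord max_card.
  by apply/card_gt0P; exists i0; rewrite inE ci0.
suff le_m : (m + n.-1 <= n.-1 * #|L| * d.-1)%N.
  by have := leq_trans bound le_m; rewrite ltnn.
apply: (@quotient_count n d m (\sum_j q j) (m - \sum_j q j) #|L|
          (\sum_(j | L j) q j) (\sum_j a j)) => //; try lia.
  by rewrite -mdegE.
Qed.

(** * Polynomials with prescribed support *)

(** Membership in a monomial ideal, homogeneity, and membership in the ideal
    of the first variables are all of this form. *)
Definition supp_in n (k : fieldType) (P : 'X_{1..n} -> Prop)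
    (f : {mpoly k[n]}) : Prop :=
  forall u, u \in msupp f -> P u.

Lemma supp_in0 n (k : fieldType) P : supp_in P (0 : {mpoly k[n]}).
Proof. by move=> u; rewrite msupp0. Qed.

Lemma supp_inD n (k : fieldType) P (f g : {mpoly k[n]}) :
  supp_in P f -> supp_in P g -> supp_in P (f + g).
Proof.
by move=> fP gP u /msuppD_le; rewrite mem_cat => /orP[/fP|/gP].
Qed.

Lemma supp_inN n (k : fieldType) P (f : {mpoly k[n]}) :
  supp_in P f -> supp_in P (- f).
Proof. by move=> fP u; rewrite (perm_mem (msuppN f)) => /fP. Qed.

Lemma supp_inB n (k : fieldType) P (f g : {mpoly k[n]}) :
  supp_in P f -> supp_in P g -> supp_in P (f - g).
Proof. by move=> fP gP; apply: supp_inD => //; apply: supp_inN. Qed.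

Lemma supp_in_sum n (k : fieldType) P (T : Type) (s : seq T) (Q : pred T)
    (F : T -> {mpoly k[n]}) :
  (forall t, Q t -> supp_in P (F t)) -> supp_in P (\sum_(t <- s | Q t) F t).
Proof.
move=> FP; elim/big_ind: _ => //; first exact: supp_in0.
exact: supp_inD.
Qed.

Lemma supp_inM n (k : fieldType) P P1 P2 (f g : {mpoly k[n]}) :
  (forall u v, P1 u -> P2 v -> P (u + v)%MM) ->
  supp_in P1 f -> supp_in P2 g -> supp_in P (f * g).
Proof.
move=> P12 fP gP u /msuppM_le /allpairsP[[v w] /= [vf wg ->]].
by apply: P12; [apply: fP | apply: gP].
Qed.

Lemma supp_inMl n (k : fieldType) P (f g : {mpoly k[n]}) :
  up_closed P -> supp_in P g -> supp_in P (f * g).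
Proof.
move=> upP gP; apply: (supp_inM _ (fun u _ => I : True) gP) => u v _.
by apply: upP; apply: lem_addl.
Qed.

Lemma supp_inMr n (k : fieldType) P (f g : {mpoly k[n]}) :
  up_closed P -> supp_in P f -> supp_in P (f * g).
Proof. by rewrite mulrC; apply: supp_inMl. Qed.

Lemma supp_inX n (k : fieldType) (P : _ -> Prop) u :
  P u -> supp_in P ('X_[u] : {mpoly k[n]}).
Proof. by move=> Pu v /mem_msuppXP <-. Qed.

Lemma supp_inZX n (k : fieldType) (P : _ -> Prop) u c :
  P u -> supp_in P (c *: 'X_[u] : {mpoly k[n]}).
Proof. by move=> Pu v /msuppZ_le; apply: supp_inX. Qed.

Lemma supp_in_sub n (k : fieldType) (P Q : _ -> Prop) (f : {mpoly k[n]}) :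
  (forall u, P u -> Q u) -> supp_in P f -> supp_in Q f.
Proof. by move=> PQ fP u /fP /PQ. Qed.

Lemma supp_in_disjoint n (k : fieldType) (P Q : _ -> Prop) (f : {mpoly k[n]}) :
  (forall u, P u -> ~ Q u) -> supp_in P f -> supp_in Q f -> f = 0.
Proof.
move=> PQ fP fQ; apply/eqP; rewrite -msupp_eq0; case E: (msupp f) => [//|u s].
have uf : u \in msupp f by rewrite E mem_head.
by case: (PQ u); [apply: fP | apply: fQ].
Qed.

Definition mpart n (k : fieldType) (P : pred 'X_{1..n}) (f : {mpoly k[n]}) :=
  \sum_(u <- msupp f | P u) f@_u *: 'X_[u].

Lemma mpart_split n (k : fieldType) (P : pred 'X_{1..n}) (f : {mpoly k[n]}) :
  f = mpart P f + mpart (predC P) f.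
Proof. by rewrite {1}[f]mpolyE (bigID P). Qed.

Lemma mpart_supp n (k : fieldType) (P : pred 'X_{1..n}) (f : {mpoly k[n]}) :
  supp_in (fun u => P u /\ u \in msupp f) (mpart P f).
Proof.
rewrite /mpart big_seq_cond; apply: supp_in_sum => u /andP[uf Pu].
exact: supp_inZX.
Qed.

Definition div_var n (k : fieldType) (x : 'I_n) (f : {mpoly k[n]}) :=
  \sum_(u <- msupp f | u x != 0%N) f@_u *: 'X_[u - U_(x)].

Lemma div_var_supp n (k : fieldType) (x : 'I_n) (f : {mpoly k[n]}) :
  supp_in (fun u => (U_(x) + u)%MM \in msupp f) (div_var x f).
Proof.
rewrite /div_var big_seq_cond; apply: supp_in_sum => u /andP[uf ux].
by apply: supp_inZX; rewrite addmC submK // lep1mP.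
Qed.

Lemma div_varK n (k : fieldType) (x : 'I_n) (f : {mpoly k[n]}) :
  'X_x * div_var x f = mpart (fun u => u x != 0%N) f.
Proof.
rewrite /div_var /mpart big_distrr /=; apply: eq_bigr => u ux.
by rewrite -scalerAr -mpolyXD addmC submK // lep1mP.
Qed.

(** The exponents of the monomials in the ideal [(x_0, ..., x_(k-1))]. *)
Definition first_vars n (k : nat) (u : 'X_{1..n}) : Prop :=
  exists2 x : 'I_n, (x < k)%N & u x != 0%N.

Lemma first_vars_up n k : up_closed (@first_vars n k).
Proof.
move=> a b /mnm_lepP ab [x xk ax]; exists x => //.
by rewrite -lt0n (leq_trans _ (ab x)) // lt0n.
Qed.

Lemma first_varsS n (x : 'I_n) u :
  first_vars x.+1 u <-> first_vars x u \/ u x != 0%N.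
Proof.
split=> [[y]|[[y yx uy]|ux]].
- rewrite ltnS leq_eqVlt => /orP[/eqP yx|yx] uy; last by left; exists y.
  by right; rewrite -(ord_inj yx).
- by exists y; rewrite // ltnS ltnW.
- by exists x.
Qed.

Lemma first_vars_full n (u : 'X_{1..n}) : first_vars n u <-> u <> 0%MM.
Proof.
split=> [[x _ ux] u0|u0]; first by rewrite u0 mnm0E in ux.
apply: contrapT => nu; apply: u0; apply/mnmP => x; rewrite mnm0E.
by apply/eqP/negPn/negP => ux; apply: nu; exists x.
Qed.

(** The variables form a regular sequence; this is what makes the long exact
    sequences behind [cycle_mod_boundary] and [socle_lift] available. *)
Lemma first_vars_reg n (k : fieldType) (x : 'I_n) (f : {mpoly k[n]}) :
  supp_in (first_vars x) ('X_x * f) -> supp_in (first_vars x) f.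
Proof.
move=> Xf u uf; have [|y yx] := Xf (U_(x) + u)%MM.
  by rewrite mcoeff_msupp mulrC mcoeffMX -mcoeff_msupp.
rewrite mnmDE mnm1E; case: (x =P y) => [xy|_]; first by rewrite xy ltnn in yx.
by rewrite add0n; exists y.
Qed.

Lemma first_vars_div n (k : fieldType) (x : 'I_n) (f : {mpoly k[n]}) :
  supp_in (first_vars x.+1) f ->
  supp_in (first_vars x) (f - 'X_x * div_var x f).
Proof.
move=> fA; rewrite div_varK {1}(mpart_split (fun u => u x != 0%N) f) addrAC.
rewrite subrr add0r.
apply: supp_in_sub _ (@mpart_supp _ _ _ _) => u [/= ux /fA].
by rewrite first_varsS (negPf ux) => -[].
Qed.

Definition row_in n (k : fieldType) r (P : 'X_{1..n} -> Prop)
    (v : 'rV[{mpoly k[n]}]_r) : Prop :=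
  forall b, supp_in P (v 0 b).

Definition row_homog n (k : fieldType) r (sh : 'I_r -> nat) (j : nat)
    (v : 'rV[{mpoly k[n]}]_r) : Prop :=
  forall b, supp_in (fun u => (mdeg u + sh b)%N = j) (v 0 b).

Lemma row_inD n (k : fieldType) r P (v w : 'rV[{mpoly k[n]}]_r) :
  row_in P v -> row_in P w -> row_in P (v + w).
Proof. by move=> vP wP b; rewrite mxE; apply: supp_inD. Qed.

Lemma row_inN n (k : fieldType) r P (v : 'rV[{mpoly k[n]}]_r) :
  row_in P v -> row_in P (- v).
Proof. by move=> vP b; rewrite mxE; apply: supp_inN. Qed.

Lemma row_in_sub n (k : fieldType) r (P Q : 'X_{1..n} -> Prop)
    (v : 'rV[{mpoly k[n]}]_r) :
  (forall u, P u -> Q u) -> row_in P v -> row_in Q v.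
Proof. by move=> PQ vP b; apply: supp_in_sub _ (vP b). Qed.

Lemma row_inMr n (k : fieldType) r s P (v : 'rV[{mpoly k[n]}]_r)
    (M : 'M[{mpoly k[n]}]_(r, s)) :
  up_closed P -> row_in P v -> row_in P (v *m M).
Proof.
move=> upP vP b; rewrite mxE; apply: supp_in_sum => a _.
by apply: supp_inMr.
Qed.

Lemma row_homogB n (k : fieldType) r sh j (v w : 'rV[{mpoly k[n]}]_r) :
  row_homog sh j v -> row_homog sh j w -> row_homog sh j (v - w).
Proof. by move=> vP wP b; rewrite !mxE; apply: supp_inB. Qed.

(** * Degree bounds along a graded free resolution *)

(** A graded complex of free modules [... -> G_1 -> G_0], exact except at
    [G_0]; it resolves the cokernel of [df 0]. *)
Record graded_resolution n (k : fieldType) := GradedResolution {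
  rk : nat -> nat;
  sh : forall i, 'I_(rk i) -> nat;
  df : forall i, 'M[{mpoly k[n]}]_(rk i.+1, rk i);
  df_homog : forall i a b,
    supp_in (fun u => (mdeg u + sh b)%N = sh a) (df i a b);
  df_df : forall i, df i.+1 *m df i = 0;
  df_exact : forall i (v : 'rV[{mpoly k[n]}]_(rk i.+1)),
    v *m df i = 0 -> exists w, v = w *m df i.+1
}.

Arguments rk {n k}.
Arguments sh {n k} _ {i}.
Arguments df {n k}.

Lemma row_homog_df n k (G : graded_resolution n k) i j (w : 'rV_(rk G i.+1)) :
  row_homog (sh G) j w -> row_homog (sh G) j (w *m df G i).
Proof.
move=> wj b; rewrite mxE; apply: supp_in_sum => a _.
apply: supp_inM _ (wj a) (@df_homog _ _ G i a b) => u v /= <- <-.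
by rewrite mdegD addnA.
Qed.

(** The differentials have degree zero, so a preimage of a homogeneous row can
    be replaced by its component of the same degree. *)
Lemma homog_lift n k (G : graded_resolution n k) i j (w : 'rV_(rk G i.+1)) :
  row_homog (sh G) j (w *m df G i) ->
  exists2 w', row_homog (sh G) j w' & w *m df G i = w' *m df G i.
Proof.
move=> vj.
pose P (a : 'I_(rk G i.+1)) : pred 'X_{1..n} :=
  fun u => (mdeg u + sh G a == j)%N.
pose w' := \row_a mpart (P a) (w 0 a).
have w'j : row_homog (sh G) j w'.
  move=> a; rewrite mxE; apply: supp_in_sub _ (@mpart_supp _ _ _ _) => u [].
  by move/eqP.
exists w' => //; apply/eqP; rewrite -subr_eq0; apply/eqP/rowP => b.
rewrite [RHS]mxE.
pose Pb (u : 'X_{1..n}) := (mdeg u + sh G b)%N = j.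
apply: (@supp_in_disjoint _ _ Pb (fun u => ~ Pb u)).
- by move=> u Pu; apply.
- exact: (row_homogB vj (row_homog_df w'j)).
rewrite -mulmxBl mxE; apply: supp_in_sum => a _; rewrite !mxE.
rewrite {1}(mpart_split (P a) (w 0 a)) addrAC subrr add0r.
apply: supp_inM _ (@mpart_supp _ _ _ _) (@df_homog _ _ G i a b) => u v [].
by move=> /eqP /= uj _ vab; rewrite /Pb mdegD -addnA vab.
Qed.

(** Cycles of the complex modulo the first [p] variables, as rows over the
    polynomial ring itself; everything in [G_0] is a cycle. *)
Definition cycle_mod n k (G : graded_resolution n k) (p i : nat) :
    'rV[{mpoly k[n]}]_(rk G i) -> Prop :=
  match i with
  | 0 => fun _ => True
  | i'.+1 => fun v => row_in (first_vars p) (v *m df G i')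
  end.

Lemma cycle_modX n k (G : graded_resolution n k) p i (x : 'I_n)
    (v : 'rV_(rk G i)) :
  cycle_mod p v -> cycle_mod p ('X_x *: v).
Proof.
case: i v => // i v vZ b; rewrite -(scalemxAl 'X_x v (df G i)) mxE.
by apply: supp_inMl => //; apply: first_vars_up.
Qed.

Lemma row_in_first_vars0 n (k : fieldType) r (v : 'rV[{mpoly k[n]}]_r) :
  row_in (first_vars 0) v -> v = 0.
Proof.
move=> v0; apply/rowP => b; rewrite mxE.
by apply: supp_in_disjoint _ (v0 b) (v0 b) => u [].
Qed.

Lemma row_in_first_varsS n (k : fieldType) r (x : 'I_n)
    (v : 'rV[{mpoly k[n]}]_r) :
  row_in (first_vars x) v -> row_in (first_vars x.+1) v.
Proof. by apply: row_in_sub => u ux; apply/first_varsS; left. Qed.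

Lemma row_in_first_varsX n (k : fieldType) r (x : 'I_n)
    (v : 'rV[{mpoly k[n]}]_r) :
  row_in (first_vars x.+1) ('X_x *: v).
Proof.
move=> b; rewrite mxE; apply: supp_inMr; first exact: first_vars_up.
by apply: supp_inX; exists x; rewrite // mnm1E eqxx.
Qed.

Lemma row_first_vars_reg n (k : fieldType) r (x : 'I_n)
    (v : 'rV[{mpoly k[n]}]_r) :
  row_in (first_vars x) ('X_x *: v) -> row_in (first_vars x) v.
Proof. by move=> Xv b; apply: first_vars_reg; have := Xv b; rewrite mxE. Qed.

Lemma row_first_vars_div n (k : fieldType) r (x : 'I_n)
    (v : 'rV[{mpoly k[n]}]_r) :
  row_in (first_vars x.+1) v ->
  exists2 y : 'rV[{mpoly k[n]}]_r, row_in (first_vars x) (v - 'X_x *: y) &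
    forall (sh : 'I_r -> nat) j, row_homog sh j v -> row_homog sh j.-1 y.
Proof.
move=> vx; exists (map_mx (div_var x) v) => [b|sh j vj b].
  by rewrite !mxE; apply: first_vars_div.
rewrite mxE; apply: supp_in_sub _ (@div_var_supp _ _ _ _) => u /vj <-.
by rewrite mdegD mdeg1.
Qed.

Lemma row_homogX n (k : fieldType) r (sh : 'I_r -> nat) j (x : 'I_n)
    (v : 'rV[{mpoly k[n]}]_r) :
  row_homog sh j v -> row_homog sh j.+1 ('X_x *: v).
Proof.
move=> vj b; rewrite mxE.
apply: supp_inM _ (@supp_inX n k (fun u => u = U_(x)%MM) _ erefl) (vj b).
by move=> _ u -> <-; rewrite mdegD mdeg1.
Qed.

(** If the resolved module [M] vanishes in degrees above [top], then
    [Tor_i(M, S/(x_0, ..., x_(p-1)))] vanishes in degrees above [top + i], and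
    altogether when [i > p].  The induction on [p] is the exact sequence
    [H_i(p) -> H_i(p+1) -> H_(i-1)(p)(-1)] of multiplication by the next
    variable, where [H_i(p)] is the homology modulo the first [p] variables:
    the connecting map sends a cycle [v] to [y] with [df v = x y] modulo the
    first [p] variables. *)
Lemma cycle_mod_boundary n k (G : graded_resolution n k) (top : nat) :
  (forall j (v : 'rV_(rk G 0)), (top < j)%N -> row_homog (sh G) j v ->
     exists w, v = w *m df G 0) ->
  forall p i j (v : 'rV_(rk G i)), (p <= n)%N ->
    (top + i < j)%N || (p < i)%N -> row_homog (sh G) j v ->
    cycle_mod p v ->
    exists2 w, row_homog (sh G) j w & row_in (first_vars p) (v - w *m df G i).
Proof.
move=> topG; elim=> [|p IHp] i j v pn ij vj vZ.
  have [w vw] : exists w, v = w *m df G i.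
    case: i ij v vj vZ => [|i] ij v vj vZ.
      by rewrite orbF addn0 in ij; apply: topG vj.
    exact/df_exact/row_in_first_vars0.
  rewrite vw in vj *; have [w' w'j ->] := homog_lift vj.
  by exists w' => // b; rewrite subrr mxE; apply: supp_in0.
pose x : 'I_n := Ordinal pn.
(* It suffices to lift v to a cycle modulo one variable less. *)
suff [v' [v'j v'Z v'v]] : exists v' : 'rV_(rk G i), [/\ row_homog (sh G) j v',
    cycle_mod p v' & row_in (first_vars p.+1) (v - v')].
  have [|w wj v'w] := IHp i j v' (ltnW pn) _ v'j v'Z; first by lia.
  exists w => //; rewrite -[v](subrK v') -addrA; apply: row_inD => //.
  exact: (@row_in_first_varsS _ _ _ x).
case: i ij v vj vZ => [|i] ij v vj vZ.
  by exists v; split=> // b; rewrite subrr mxE; apply: supp_in0.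
have [y yv /(_ _ _ (row_homog_df vj)) yj] := @row_first_vars_div _ _ _ x _ vZ.
have yZ : cycle_mod p y.
  case: i ij v vj vZ y yj yv => [//|i] ij v vj vZ y yj yv /=.
  apply: (@row_first_vars_reg _ _ _ x); rewrite scalemxAl.
  have := @row_inMr _ _ _ _ _ _ (df G i) (@first_vars_up n p) yv.
  rewrite mulmxBl -mulmxA df_df mulmx0 sub0r => /row_inN.
  by rewrite opprK.
(* In degree 0 the boundary of v, having all its entries in the ideal of the
   variables, vanishes. *)
have [j0|j0] := posnP j.
  exists v; split=> //; last by move=> b; rewrite subrr mxE; apply: supp_in0.
  suff v0 : v *m df G i = 0 by move=> b; rewrite /= v0 mxE; apply: supp_in0.
  apply/rowP => b; rewrite [RHS]mxE.
  apply: (supp_in_disjoint _ (vZ b) (row_homog_df vj (b := b))) => u [z _ uz].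
  rewrite j0 => /eqP; rewrite addn_eq0 mdeg_eq0 => /andP[/eqP u0].
  by rewrite u0 mnm0E in uz.
have [|w wj wy] := IHp i j.-1 y (ltnW pn) _ yj yZ; first by lia.
(* The class of y vanishes, which allows to correct v by a multiple of x. *)
exists (v - 'X_x *: w); split.
- by apply: row_homogB => //; rewrite -(prednK j0); apply: row_homogX.
- rewrite /= mulmxBl -(scalemxAl 'X_x w (df G i)).
  rewrite -(subrK ('X_x *: y) (v *m df G i)) -addrA -scalerBr.
  apply: row_inD => // b; rewrite mxE.
  by apply: supp_inMl => //; apply: first_vars_up.
- rewrite opprB addrC subrK; exact: (@row_in_first_varsX _ _ _ x).
Qed.

(** In the same exact sequence, [H_p(p)] in degree [top + p] is killed by the
    next variable, since degree [top + p + 1] is zero by [cycle_mod_boundary].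
    It is therefore in the image of the connecting map from [H_(p+1)(p+1)],
    and a preimage of a nonzero class is nonzero. *)
Lemma socle_lift n k (G : graded_resolution n k) (top : nat) :
  (forall j (v : 'rV_(rk G 0)), (top < j)%N -> row_homog (sh G) j v ->
     exists w, v = w *m df G 0) ->
  (exists2 v : 'rV_(rk G 0), row_homog (sh G) top v &
     forall w, v <> w *m df G 0) ->
  forall p, (p <= n)%N ->
    exists v : 'rV_(rk G p), [/\ row_homog (sh G) (top + p) v, cycle_mod p v &
      forall w, ~ row_in (first_vars p) (v - w *m df G p)].
Proof.
move=> topG [v0 v0top v0N]; elim=> [|p IHp] pn.
  exists v0; split; rewrite ?addn0 // => w /row_in_first_vars0 /eqP.
  by rewrite subr_eq0 => /eqP /v0N.
have [y [yj yZ yN]] := IHp (ltnW pn); pose x : 'I_n := Ordinal pn.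
have XyZ : cycle_mod p ('X_x *: y) by exact: cycle_modX.
have [|v vj vy] := @cycle_mod_boundary _ _ _ _ topG p p (top + p).+1 _ (ltnW pn)
  _ (@row_homogX _ _ _ _ _ x _ yj) XyZ; first by rewrite ltnSn.
exists v; split.
- by rewrite addnS.
- rewrite /= -(opprK (v *m _)); apply: row_inN.
  rewrite -[X in row_in _ X](addKr ('X_x *: y)); apply: row_inD.
    by apply: row_inN; apply: (@row_in_first_varsX _ _ _ x).
  exact: (@row_in_first_varsS _ _ _ x).
move=> w vw.
have [y' vy' _] := @row_first_vars_div _ _ _ x _ vw.
apply: (yN y'); apply: (@row_first_vars_reg _ _ _ x).
rewrite scalerBr scalemxAl.
have := @row_inMr _ _ _ _ _ _ (df G p) (@first_vars_up n p) vy'.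
rewrite !mulmxBl -mulmxA df_df mulmx0 subr0 => vy'd.
by have := row_inD vy vy'd; rewrite addrA subrK.
Qed.

(** * Regularity of a monomial ideal of finite colength *)

(** Prepending [S] in degree zero turns a resolution of [J] into one of [S/J],
    whose homology is finite dimensional from the start. *)
Section Augmentation.
Variables (n : nat) (k : fieldType) (J : {mpoly k[n]} -> Prop).
Variable F : min_graded_free_resolution J.

Definition aug_rank (i : nat) : nat := if i is i'.+1 then rank F i' else 1.

Definition aug_shift (i : nat) : 'I_(aug_rank i) -> nat :=
  match i with
  | 0 => fun _ => 0%N
  | i'.+1 => fun a : 'I_(rank F i') => shift a
  end.

Definition aug_diff (i : nat) : 'M[{mpoly k[n]}]_(aug_rank i.+1, aug_rank i) :=
  match i with
  | 0 => aug F
  | i'.+1 => diff F i'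
  end.

Lemma aug_diff_homog i (a : 'I_(aug_rank i.+1)) (b : 'I_(aug_rank i)) :
  supp_in (fun u => (mdeg u + aug_shift b)%N = aug_shift a) (aug_diff i a b).
Proof.
case: i a b => [|i] a b u; last exact: diff_homog.
by rewrite /= addn0 (ord1 b) => /(dhomogP _ _ _ (aug_homog a)).
Qed.

Lemma aug_diff_diff i : aug_diff i.+1 *m aug_diff i = 0.
Proof.
apply/row_matrixP => a; rewrite row_mul row0.
case: i a => [|i] a.
  by apply: (proj2 (aug_exact _)); exists (delta_mx 0 a); rewrite -rowE.
by apply: (proj2 (diff_exact _)); exists (delta_mx 0 a); rewrite -rowE.
Qed.

Lemma aug_diff_exact i (v : 'rV[{mpoly k[n]}]_(aug_rank i.+1)) :
  v *m aug_diff i = 0 -> exists w, v = w *m aug_diff i.+1.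
Proof.
by case: i v => [|i] v => [/(proj1 (aug_exact _))|/(proj1 (diff_exact _))].
Qed.

Definition aug_resolution : graded_resolution n k :=
  GradedResolution aug_diff_homog aug_diff_diff aug_diff_exact.

End Augmentation.

Lemma irrelevant_supp n (k : fieldType) (f : {mpoly k[n]}) :
  irrelevant_ideal f -> supp_in (first_vars n) f.
Proof.
case=> r [c [g [gX ->]]]; apply: supp_in_sum => i _.
apply: supp_inMl; first exact: first_vars_up.
have [x ->] := gX i; apply: supp_inX.
by exists x; rewrite ?mnm1E ?eqxx.
Qed.

Lemma aug_mulmx_image n (k : fieldType) (J : {mpoly k[n]} -> Prop)
    (F : min_graded_free_resolution J) (v : 'rV[{mpoly k[n]}]_1) :
  J (v 0 0) <-> exists w, v = w *m df (aug_resolution F) 0.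
Proof.
rewrite (aug_image F); split=> [][w vw]; exists w; last by rewrite vw.
by apply/rowP => b; rewrite ord1 vw.
Qed.

(** A basis vector of [G_i] is a cycle modulo all variables by minimality, and
    never a boundary, so [cycle_mod_boundary] restricts its degree; the bound
    on [i] is Hilbert's syzygy theorem. *)
Lemma shift_bound n (k : fieldType) (G : graded_resolution n k) top :
  (forall i a b, supp_in (first_vars n) (df G i a b)) ->
  (forall j (v : 'rV_(rk G 0)), (top < j)%N -> row_homog (sh G) j v ->
     exists w, v = w *m df G 0) ->
  forall i (a : 'I_(rk G i)), (sh G a <= top + i)%N && (i <= n)%N.
Proof.
move=> Gmin topG i a; pose v : 'rV[{mpoly k[n]}]_(rk G i) := delta_mx 0 a.
apply/negPn/negP; rewrite negb_and -!ltnNge => ia.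
have vj : row_homog (sh G) (sh G a) v.
  move=> b u; rewrite mxE eqxx /=; case: eqP => [->|_]; last by rewrite msupp0.
  by rewrite msupp1 inE => /eqP ->; rewrite mdeg0.
have vZ : cycle_mod n v.
  case: (i) (v) => // i' v' b; rewrite mxE; apply: supp_in_sum => c _.
  by apply: supp_inMl => //; apply: first_vars_up.
have [w _ vw] := cycle_mod_boundary topG (leqnn n) ia vj vZ.
have := @supp_inD _ _ _ _ ((w *m df G i) 0 a) (vw a).
rewrite !mxE !eqxx subrK => ax; have [||x _] := ax _ 0%MM.
- by apply: supp_in_sum => c _; apply: supp_inMl => //; apply: first_vars_up.
- by rewrite /= mcoeff_msupp mcoeff1 eqxx oner_neq0.
- by rewrite mnm0E.
Qed.

(** [shift_bound] gives the upper estimate for the shifts.  It is attained in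
    homological degree [n] of the resolution of [S/J]: [socle_lift], starting
    from a monomial of top degree outside [J], produces an element of degree
    [top + n] that is nonzero modulo the variables.  The case [n = 0] is
    impossible, because then [J = 0] has no generators and its regularity is
    not defined. *)
Lemma regularity_cofinite_monomial n (k : fieldType)
    (J : {mpoly k[n]} -> Prop) (E : 'X_{1..n} -> Prop) (top : nat) (r : int) :
  up_closed E -> (forall f, J f <-> supp_in E f) ->
  (forall u, (top < mdeg u)%N -> E u) -> (exists2 u, mdeg u = top & ~ E u) ->
  castelnuovo_mumford_regularity J r -> (0 < n)%N /\ r = top.+1%:Z.
Proof.
move=> upE JE topE [u0 u0top u0E] [F [[i [a ra]] rmax]].
pose G := aug_resolution F.
have Gmin j b c : supp_in (first_vars n) (df G j b c).
  case: j b c => [|j] b c; last exact/irrelevant_supp/diff_minimal.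
  move=> u uf; apply/first_vars_full => u0'; rewrite u0' in uf.
  have : J (aug F b 0).
    by apply/(aug_image F); exists (delta_mx 0 b); rewrite -rowE mxE.
  move/JE => augE; apply: u0E; apply: (upE 0%MM).
    by apply/mnm_lepP => x; rewrite mnm0E.
  by apply: augE; rewrite /= (ord1 c) in uf.
have topG j (v : 'rV_(rk G 0)) : (top < j)%N -> row_homog (sh G) j v ->
    exists w, v = w *m df G 0.
  move=> jtop vj; apply/aug_mulmx_image/JE => u /vj /=.
  by rewrite addn0 => uj; apply: topE; rewrite uj.
have bound := shift_bound Gmin topG.
have ler p (b : 'I_(rk G p)) : (0 < p)%N -> (sh G b)%:Z - p.-1%:Z <= r.
  by case: p b => // p b _; apply: rmax.
have n0 : (0 < n)%N.
  by have /andP[_] := bound i.+1 a; apply: leq_trans.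
split=> //; apply/eqP; rewrite eq_le; apply/andP; split.
  by have /andP[] := bound i.+1 a; rewrite ra /=; lia.
have [|v [vj _ vN]] := socle_lift topG _ (leqnn n).
  exists (\row__ 'X_[u0]) => [b|w vw].
    by rewrite mxE; apply: supp_inX; rewrite /= addn0.
  apply: u0E; have /JE : J ((\row_(_ < 1) 'X_[u0] : 'rV[{mpoly k[n]}]_1) 0 0).
    by apply/(aug_mulmx_image F); exists w.
  by rewrite mxE; apply; rewrite msuppX mem_head.
have [b [u [ub uN]]] : exists b u, u \in msupp (v 0 b) /\ ~ first_vars n u.
  apply: contrapT => vax; apply: (vN 0) => b u; rewrite mul0mx subr0 => ub.
  by apply: contrapT => uN; apply: vax; exists b, u.
have u_0 : u = 0%MM by apply: contrapT => /first_vars_full.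
have := vj b u ub; rewrite u_0 mdeg0 add0n.
move=> shb; have := ler n b n0; rewrite shb; lia.
Qed.

(** * Ideals spanned by monomials *)

Lemma ideal_span_gen (R : comNzRingType) (A : R -> Prop) g :
  A g -> ideal_span A g.
Proof.
by move=> Ag; exists 1%N, (fun=> 1), (fun=> g); rewrite big_ord1 mul1r.
Qed.

Lemma ideal_span0 (R : comNzRingType) (A : R -> Prop) : ideal_span A 0.
Proof.
by exists 0%N, (fun=> 0), (fun=> 0); split=> [[]//|]; rewrite big_ord0.
Qed.

Lemma ideal_spanD (R : comNzRingType) (A : R -> Prop) f g :
  ideal_span A f -> ideal_span A g -> ideal_span A (f + g).
Proof.
move=> [r [c [h [hA ->]]]] [s [b [l [lA ->]]]].
pose join (x : 'I_r -> R) (y : 'I_s -> R) (i : 'I_(r + s)) :=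
  match split i with inl j => x j | inr j => y j end.
exists (r + s)%N, (join c b), (join h l); split=> [i|].
  by rewrite /join; case: split.
rewrite big_split_ord /=; congr (_ + _); apply: eq_bigr => i _.
  by rewrite /join (unsplitK (inl i)).
by rewrite /join (unsplitK (inr i)).
Qed.

Lemma ideal_spanMl (R : comNzRingType) (A : R -> Prop) a f :
  ideal_span A f -> ideal_span A (a * f).
Proof.
move=> [r [c [h [hA ->]]]]; exists r, (fun i => a * c i), h; split=> //.
by rewrite big_distrr; apply: eq_bigr => i _ /=; rewrite mulrA.
Qed.

Lemma span_supp n (k : fieldType) (E : 'X_{1..n} -> Prop)
    (A : {mpoly k[n]} -> Prop) f :
  up_closed E -> (forall g, A g -> supp_in E g) ->
  ideal_span A f -> supp_in E f.
Proof.
move=> upE AE [r [c [g [gA ->]]]]; apply: supp_in_sum => i _.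
by apply: supp_inMl => //; apply: AE.
Qed.

Lemma supp_span n (k : fieldType) (E : 'X_{1..n} -> Prop)
    (A : {mpoly k[n]} -> Prop) f :
  (forall u, E u -> ideal_span A 'X_[u]) -> supp_in E f -> ideal_span A f.
Proof.
move=> EA fE; rewrite [f]mpolyE big_seq; elim/big_ind: _ => [||u uf].
- exact: ideal_span0.
- exact: ideal_spanD.
- by rewrite -mul_mpolyC; apply/ideal_spanMl/EA/fE.
Qed.

Definition monomials n (k : fieldType) (I : {mpoly k[n]} -> Prop)
  (u : 'X_{1..n}) : Prop := I 'X_[u].

Lemma monomial_ideal_supp n (k : fieldType) (I : {mpoly k[n]} -> Prop) :
  monomial_ideal I ->
  up_closed (monomials I) /\ forall f, I f <-> supp_in (monomials I) f.
Proof.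
move=> [A IA]; pose E u := exists2 a, A a & (a <= u)%MM.
have upE : up_closed E.
  by move=> u v uv [a Aa au]; exists a => //; apply: lepm_trans au uv.
have IE f : I f <-> supp_in E f.
  rewrite IA; split.
    apply: span_supp => // _ [a Aa ->]; apply: supp_inX.
    by exists a => //; apply: lepm_refl.
  apply: supp_span => u [a Aa au]; rewrite -(submK au) mpolyXD.
  by apply/ideal_spanMl/ideal_span_gen; exists a.
have mE u : monomials I u <-> E u.
  rewrite /monomials IE; split=> [|Eu]; last exact: supp_inX.
  by apply; rewrite msuppX mem_head.
split=> [u v uv /mE Eu|f]; first by apply/mE; apply: upE Eu.
by rewrite IE; split; apply: supp_in_sub => u /mE.
Qed.

Lemma ideal_pow_supp n (k : fieldType) (J : {mpoly k[n]} -> Prop) E m f :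
  (forall g, J g <-> supp_in E g) ->
  ideal_pow J m f <-> supp_in (exp_pow E m) f.
Proof.
move=> JE; elim: m f => [|m IHm] f.
  by split=> // _ u _; apply: exp_pow0.
split.
  apply: span_supp; first exact: exp_pow_up.
  move=> _ [g [h [/JE gE /IHm hE ->]]].
  by apply: supp_inM _ gE hE => u v; apply: exp_powS_add.
apply: supp_span => u /exp_powS[g [Eg gu Eug]]; apply: ideal_span_gen.
exists 'X_[g], 'X_[u - g]; split.
- by apply/JE; apply: supp_inX.
- by apply/IHm; apply: supp_inX.
- by rewrite -mpolyXD addmC submK.
Qed.

Definition exp_le_degree n (E : 'X_{1..n} -> Prop) t (u : 'X_{1..n}) : Prop :=
  exists b : 'X_{1..n}, [/\ E b, (b <= u)%MM & (mdeg b <= t)%N].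

Lemma ideal_le_degree_supp n (k : fieldType) (J : {mpoly k[n]} -> Prop) E t f :
  (forall g, J g <-> supp_in E g) ->
  ideal_le_degree J t f <-> supp_in (exp_le_degree E t) f.
Proof.
move=> JE; split.
  apply: span_supp => [u v uv [b [Eb bu bt]]|].
    by exists b; split=> //; apply: lepm_trans bu uv.
  move=> p [/JE pE [s st /dhomogP ps]] u up.
  exists u; split; [exact: pE | exact: lepm_refl |].
  by rewrite (ps u up).
apply: supp_span => u [b [Eb bu bt]]; rewrite -(submK bu) mpolyXD.
apply/ideal_spanMl/ideal_span_gen; split; first by apply/JE; apply: supp_inX.
by exists (mdeg b) => //; rewrite dhomogX.
Qed.

Lemma supp_inXn n (k : fieldType) (P : nat -> 'X_{1..n} -> Prop) (Q : _ -> Prop)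
    (f : {mpoly k[n]}) m :
  P 0%N 0%MM -> (forall i u v, Q u -> P i v -> P i.+1 (u + v)%MM) ->
  supp_in Q f -> supp_in (P m) (f ^+ m).
Proof.
move=> P0 PS fQ; elim: m => [|m IHm].
  by rewrite expr0 -mpolyX0; apply: supp_inX.
by rewrite exprS; apply: supp_inM _ fQ IHm => u v; apply: PS.
Qed.

(** The radical of [I] contains every variable, so the least exponents
    exist. *)
Lemma pure_exponents_exist n (k : fieldType) (I : {mpoly k[n]} -> Prop) :
  up_closed (monomials I) -> primary_to (@irrelevant_ideal n k) I ->
  exists c, pure_exponents (monomials I) c.
Proof.
move=> upI [[I1 _] Irad].
suff /choice[c cE] : forall j, exists c, (0 < c)%N /\
    forall r, monomials I (U_(j) *+ r)%MM <-> (c <= r)%N by exists c.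
move=> j.
have exP : exists r, `[< monomials I (U_(j) *+ r)%MM >].
  have [|r Ir] := (Irad 'X_j).2; first by apply: ideal_span_gen; exists j.
  by exists r; apply/asboolP; rewrite /monomials -mpolyXn.
have [c /asboolP Ec cmin] := ex_minnP exP; exists c; split.
  rewrite lt0n; apply/eqP => c0; apply: I1.
  by rewrite -mpolyX0; rewrite c0 mulm0n in Ec.
move=> r; split=> [Er|cr]; first by apply: cmin; apply/asboolP.
apply: upI Ec; apply/mnm_lepP => i; rewrite !mulmnE.
by rewrite leq_mul2l cr orbT.
Qed.

(** * The asymptotic generating degree *)

(** If [t < c j], every monomial of [I_(<= t)] involves a variable other than
    [x_j], hence so does every monomial of the terms [a_i f^(r-i)], [i >= 1],
    of an integral equation. For [f = x_j^(c j)] the leading term [f^r] could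
    not cancel. *)
Lemma pure_exponent_le n (k : fieldType) (I : {mpoly k[n]} -> Prop) c t j :
  (forall f, I f <-> supp_in (monomials I) f) ->
  pure_exponents (monomials I) c -> integral_over_le_degree I t ->
  (c j <= t)%N.
Proof.
move=> IE cE Iint; rewrite leqNgt; apply/negP => tc.
pose E := exp_le_degree (monomials I) t.
have JE f : ideal_le_degree I t f <-> supp_in E f.
  by apply: ideal_le_degree_supp.
pose Q (u : 'X_{1..n}) := exists2 y, y != j & u y != 0%N.
have upQ : up_closed Q.
  move=> a b /mnm_lepP ab [y yj ay]; exists y => //.
  by rewrite -lt0n (leq_trans _ (ab y)) // lt0n.
have EQ u : E u -> Q u.
  move=> [b [Eb bu bt]]; apply: (upQ b) => //; apply: contrapT => nQ.
  have bE : b = (U_(j) *+ b j)%MM.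
    apply/mnmP => y; rewrite mulmnE mnm1E; have [<-|jy] := eqVneq j y.
      by rewrite mul1n.
    rewrite mul0n; apply/eqP/negPn/negP => by0; apply: nQ.
    by exists y; rewrite // eq_sym.
  rewrite bE in Eb; have := ((cE j).2 _).1 Eb; rewrite leqNgt => /negP; apply.
  apply: leq_ltn_trans tc; apply: leq_trans bt.
  by rewrite {2}bE mdegMn mdeg1 mul1n.
have powQ m u : (0 < m)%N -> exp_pow E m u -> Q u.
  by case: m => // m _ /exp_powS[g [/EQ gQ gu _]]; apply: upQ gQ.
have [|r [a [r0 aJ int_eq]]] := Iint 'X_[U_(j) *+ c j].
  by apply/(cE j).2.
have sumQ : supp_in Q (\sum_(1 <= i < r.+1) a i * 'X_[U_(j) *+ c j] ^+ (r - i)).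
  rewrite big_nat; apply: supp_in_sum => i ir; apply: supp_inMr => //.
  have /(ideal_pow_supp _ _ JE) ai := aJ i ir.
  by apply: supp_in_sub ai => u; apply: powQ; case/andP: ir.
have : supp_in Q ('X_[U_(j) *+ c j] ^+ r : {mpoly k[n]}).
  by move/eqP: int_eq; rewrite addr_eq0 => /eqP ->; apply: supp_inN.
rewrite mpolyXn => /(_ (U_(j) *+ c j *+ r)%MM).
rewrite msuppX mem_head => /(_ isT)[y yj].
by rewrite !mulmnE mnm1E [j == y]eq_sym (negPf yj).
Qed.

(** An explicit integral equation for [f = p + q], where [p] collects the
    monomials of degree at most [t]. A monomial of degree above [t] is strictly
    inside the Newton polyhedron of the pure powers, so the surplus
    accumulates: a product of [r = t n + 1] of them has degree at least
    [r (t + 1)] and contains [r] pure powers.  Hence [(f - p)^r = q^r] lies in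
    the [r]-th power of [I_(<= t)]. *)
Lemma integral_over_max_pure_degree n (k : fieldType) (I : {mpoly k[n]} -> Prop)
    c t :
  (forall f, I f <-> supp_in (monomials I) f) ->
  pure_exponents (monomials I) c -> (forall j, c j <= t)%N ->
  integral_over_le_degree I t.
Proof.
move=> IE cE ct f /IE fE.
pose E := exp_le_degree (monomials I) t.
have JE g : ideal_le_degree I t g <-> supp_in E g.
  by apply: ideal_le_degree_supp.
pose p := mpart (fun u => mdeg u <= t)%N f.
pose q := mpart (predC (fun u => mdeg u <= t)%N) f.
have fpq : f = p + q by exact: mpart_split.
have pE : supp_in E p.
  apply: supp_in_sub _ (@mpart_supp _ _ _ _) => u [ut /fE Eu].
  by exists u; split=> //; apply: lepm_refl.
pose r := (t * n).+1.
have qE : supp_in (exp_pow E r) (q ^+ r).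
  have := @supp_inXn n k (fun m u => m * t.+1 <= mdeg u)%N
    (fun u => t < mdeg u)%N q r.
  move=> /(_ isT) H; apply: supp_in_sub (H _ _) => [u ru|i u v tu iv|].
  - apply: (exp_pow_high_degree (c := c) (t := t)) => [j|j|].
    + by rewrite ct andbT; case: (cE j).
    + exists (U_(j) *+ c j)%MM; split; first exact/(cE j).2.
        exact: lepm_refl.
      by rewrite mdegMn mdeg1 mul1n.
    + by rewrite /r /= in ru *; nia.
  - by rewrite mdegD mulSn leq_add.
  - by apply: supp_in_sub _ (@mpart_supp _ _ _ _) => u [/=]; rewrite -ltnNge.
(* The coefficients of (f - p)^r - q^r as a polynomial in f. *)
pose a i := ((-1) ^+ i *+ 'C(r, i)) * p ^+ i - (if i == r then q ^+ r else 0).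
exists r, a; split=> // [i ir|].
  apply/(ideal_pow_supp _ _ JE); apply: supp_inB.
    apply: supp_inMl; first exact: exp_pow_up.
    apply: (supp_inXn (P := exp_pow E) _ _ pE); first exact: exp_pow0.
    by move=> m u v; apply: exp_powS_add.
  by case: eqP => [->//|_]; apply: supp_in0.
have pqr : (f - p) ^+ r = q ^+ r by rewrite fpq addrAC subrr add0r.
rewrite exprBn -(big_mkord predT (fun i =>
  ((-1) ^+ i * f ^+ (r - i) * p ^+ i) *+ 'C(r, i))) big_ltn //= in pqr.
rewrite expr0 mul1r subn0 mulr1 bin0 mulr1n in pqr.
rewrite (eq_big_nat _ _ (F2 := fun i =>
  ((-1) ^+ i * f ^+ (r - i) * p ^+ i) *+ 'C(r, i)
    - (if i == r then q ^+ r else 0))); last first.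
  move=> i _; rewrite /a mulrBl; congr (_ - _).
    by rewrite -!mulrnAl mulrAC.
  by case: eqP => [->|_]; rewrite ?mul0r // subnn expr0 mulr1.
rewrite sumrB addrA pqr; apply/eqP; rewrite subr_eq0; apply/eqP.
rewrite big_nat_recr //= eqxx big_nat big1 ?add0r // => i /andP[_ ir].
by rewrite (ltn_eqF ir).
Qed.

Lemma asymptotic_generating_degree_pure n (k : fieldType)
    (I : {mpoly k[n]} -> Prop) c d :
  (0 < n)%N -> (forall f, I f <-> supp_in (monomials I) f) ->
  pure_exponents (monomials I) c -> asymptotic_generating_degree I d ->
  (forall j, c j <= d)%N /\ exists i, c i = d.
Proof.
move=> n0 IE cE [Iint dmin].
have cd j : (c j <= d)%N by apply: pure_exponent_le Iint.
split=> //; have [i ci] : {i | \max_j c j = c i}.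
  by apply: bigop.eq_bigmax; rewrite card_ord.
exists i; apply/eqP; rewrite eqn_leq cd -ci /=; apply: dmin.
apply: integral_over_max_pure_degree cE _ => // j.
exact: leq_bigmax.
Qed.

Lemma num_pure_powers_card n (k : fieldType) (I : {mpoly k[n]} -> Prop) c d :
  pure_exponents (monomials I) c ->
  num_pure_powers I d = #|[pred i | c i == d]|.
Proof.
move=> cE; rewrite /num_pure_powers cardsE; apply: eq_card => i.
rewrite !inE; apply/asboolP/eqP => [[Id dmin]|<-].
  have Ec : monomials I (U_(i) *+ c i)%MM by apply/(cE i).2.
  have le_c : (U_(i) *+ c i <= U_(i) *+ d)%MM.
    apply/mnm_lepP => j; rewrite !mulmnE leq_mul2l.
    by rewrite ((cE i).2 d).1 ?orbT.
  have /(congr1 (fun u : 'X_{1..n} => u i)) := dmin _ Ec le_c.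
  by rewrite !mulmnE mnm1E eqxx !mul1n.
split=> [|b Ib /mnm_lepP bc]; first exact: ((cE i).2 (c i)).2.
have bE : b = (U_(i) *+ b i)%MM.
  apply/mnmP => y; rewrite mulmnE mnm1E; have [<-|iy] := eqVneq i y.
    by rewrite mul1n.
  by have := bc y; rewrite mulmnE mnm1E (negPf iy) mul0n leqn0 => /eqP.
have c_le : (c i <= b i)%N by apply/(cE i).2; rewrite -bE.
have := bc i; rewrite mulmnE mnm1E eqxx mul1n => b_le.
by rewrite bE; congr (_ *+ _)%MM; apply/eqP; rewrite eqn_leq b_le.
Qed.

(** * Stabilization of the regularity defect *)

Lemma regularity_ideal_pow n (k : fieldType) (I : {mpoly k[n]} -> Prop) c m r :
  (forall f, I f <-> supp_in (monomials I) f) ->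
  pure_exponents (monomials I) c -> ~ I 1 -> (0 < m)%N ->
  castelnuovo_mumford_regularity (ideal_pow I m) r ->
  (0 < n)%N /\ exists top, [/\ r = top.+1%:Z,
    forall u, ~ exp_pow (monomials I) m u -> (mdeg u <= top)%N &
    exists2 u : 'X_{1..n}, mdeg u = top & ~ exp_pow (monomials I) m u].
Proof.
move=> IE cE I1 m0 reg_r.
have E0 : ~ monomials I 0%MM by rewrite /monomials mpolyX0.
have [top [topE topN]] := exp_pow_top cE E0 m0.
have [n0 ->] := regularity_cofinite_monomial (@exp_pow_up _ _ m)
  (fun f => ideal_pow_supp m f IE) topE topN reg_r.
split=> //; exists top; split=> // u uN.
by rewrite leqNgt; apply/negP => /topE.
Qed.

Theorem theorem3p1 (n : nat) (k : fieldType) (k_char0 : [pchar k] =i pred0)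
    (I : {mpoly k[n]} -> Prop)
    (I_monomial : monomial_ideal I)
    (I_primary : primary_to (@irrelevant_ideal n k) I)
    (d : nat) (d_agd : asymptotic_generating_degree I d)
    (l : nat) (l_def : l = num_pure_powers I d)
    (e : nat -> int)
    (e_def : forall m : nat, (0 < m)%N ->
       castelnuovo_mumford_regularity (ideal_pow I m) (d%:Z * m%:Z + e m)) :
  forall m : nat, (0 < m)%N ->
    Num.max (n%:Z - 1) ((n%:Z - 1) * (l%:Z * (d%:Z - 1) - 1)) < m%:Z ->
    e m.+1 = e m.
Proof.
move=> m m0; rewrite gt_max => /andP[lt_nm lt_bound].
have [upI IE] := monomial_ideal_supp I_monomial.
have [c cE] := pure_exponents_exist upI I_primary.
have I1 : ~ I 1 by case: I_primary => [[]].
have reg p := @regularity_ideal_pow n k I c p _ IE cE I1.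
have [n0 [D [regD Dmax [u uD uN]]]] := reg _ m m0 (e_def m m0).
have [_ [D' [regD' D'max [v vD' vN]]]] := reg _ m.+1 isT (e_def m.+1 isT).
have [cd [i ci]] := asymptotic_generating_degree_pure n0 IE cE d_agd.
have d0 : (0 < d)%N by rewrite -ci; case: (cE i).
(* The top degree outside I^p is at least d p - 1, because of the powers of a
   variable whose pure exponent is d. *)
have le_top p (x : 'X_{1..n}) : (0 < p)%N ->
    (forall y, ~ exp_pow (monomials I) p y -> mdeg y <= mdeg x)%N ->
    (d * p <= (mdeg x).+1)%N.
  move=> p0 xmax; have := xmax (U_(i) *+ (p * d).-1)%MM.
  rewrite mdegMn mdeg1 mul1n => below.
  have pd0 : (0 < p * d)%N by rewrite muln_gt0 p0.
  suff : ((p * d).-1 <= mdeg x)%N by lia.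
  by apply: below; apply: exp_pow_pure_below cE _; rewrite ci prednK.
have [w wN le_w] : exists2 w : 'X_{1..n},
    ~ exp_pow (monomials I) m w & (mdeg v <= mdeg w + d)%N.
  apply: (exp_pow_drop cE cd) vN; first by lia.
  by apply: le_top => // y; rewrite vD'; apply: D'max.
have [z zN le_z] : exists2 z : 'X_{1..n},
    ~ exp_pow (monomials I) m.+1 z & (mdeg u + d <= mdeg z)%N.
  apply: (exp_pow_rise cE cd) uN; first by exists i.
    rewrite -(num_pure_powers_card d cE) -l_def.
    move: lt_bound; case: (n) n0 => // n' _; case: (d) d0 => // d' _ /=; nia.
  by apply: le_top => // y; rewrite uD; apply: Dmax.
have := Dmax w wN; have := D'max z zN; move: regD regD'; nia.
Qed.
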